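(* Let $X$ be a proper, geodesic, Gromov hyperbolic metric space with basepoint $o \in X$, and let $\rho$ be a visual metric on $\partial X$. Let $\Gamma \subset \operatorname{Isom}(X)$ be a non-elementary discrete subgroup whose limit set $\Lambda(\Gamma)$ is uniformly perfect (with respect to $\rho$), and let $\{H_j\}$ be a pairwise disjoint collection of horoballs in $X$. Then the set of points of $\Lambda(\Gamma)$ which are badly approximable by $\{H_j\}$ is absolutely winning in $\Lambda(\Gamma)$.
   Context: **Hyperbolic spaces.** A metric space is proper if all closed balls are compact. A geodesic is an isometric embedding of an interval; $X$ is geodesic if any two points are joined by a geodesic. $X$ is Gromov hyperbolic if it is geodesic and there is $\delta\ge 0$ such that for all $a,b,c\in X$ (and all choices of geodesics) $[b,c]\subset N_\delta([a,b])\cup N_\delta([a,c])$, where $N_\delta$ denotes the $\delta$-neighborhood. The boundary $\partial X$ is the set of equivalence classes of geodesic rays $[0,\infty)\to X$, with $\gamma\sim\sigma$ iff $d(\gamma(t),\sigma(t))<C$ for some $C>0$ and all sufficiently large $t$; the class of $\gamma$ is written $\gamma(\infty)$. The Gromov product is $(x|y)=\frac12(d(x,o)+d(y,o)-d(x,y))$ for $x,y\in X$. Equivalently, $\partial X$ is the set of classes of sequences $(x_i)$ in $X$ with $\lim_{i,j\to\infty}(x_i|x_j)=\infty$, where $(x_i)\sim(y_i)$ iff $\lim_{i,j\to\infty}(x_i|y_j)=\infty$. For $\xi,\nu\in\partial X$, $(\xi|\nu)=\inf\liminf_{i,j\to\infty}(x_i|y_j)$, the infimum being over all sequences $(x_i)$,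 $(y_j)$ representing $\xi,\nu$. A visual metric on $\partial X$ is a metric $\rho$ for which there are $C>1$, $a>1$ with $\frac1C a^{-(x|y)}<\rho(x,y)<Ca^{-(x|y)}$ for all distinct $x,y\in\partial X$. Balls in $\partial X$ are taken with respect to $\rho$. **Horoballs and bad approximability.** For a geodesic ray $\gamma$, the Busemann function is $b_\gamma(z)=\lim_{t\to\infty}(d(\gamma(t),z)-t)$. A horoball based at $\gamma(\infty)$ is a set of the form $b_\gamma^{-1}(-\infty,s]$, $s\in\mathbb{R}$. The shadow $Sh(A)$ of $A\subset X$ is the set of endpoints in $\partial X$ of geodesic rays starting at $o$ which intersect $A$. The radius of a horoball $H$ based at $\xi$ is the infimum of those $R$ such that $Sh(H)\subset B(\xi,R)$. For a collection $\{H_j\}$ of horoballs based at $\xi_j$ with radii $R_j$, a point $x\in\partial X$ is badly approximable by $\{H_j\}$ if there exists $s>0$ such that $\rho(x,\xi_j)>s\,R_j$ for every $j$. **Limit sets.** Discreteness of $\Gamma$ means that $\Gamma$ acts properly discontinuously on $X$: $\{\gamma\in\Gamma: B(x,r)\cap\gamma B(x,r)\neq\emptyset\}$ is finite for all $x\in X$, $r>0$. The limit set $\Lambda(\Gamma)\subset\partial X$ is the set of boundary points represented by sequences $(x_i)$ with $x_i=\gamma_i\cdot o$, $\gamma_i\in\Gamma$. $\Gamma$ is non-elementary if $\Lambda(\Gamma)$ is infinite. **Uniform perfectness.** A metric space $Y$ is uniformly perfect if there is $0<\nu<1$ such that for every ball $B(x,R)$ with $Y\setminus B(x,R)\ne\emptyset$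 one has $B(x,R)\setminus B(x,\nu R)\neq\emptyset$; a subset is uniformly perfect if it is so with the induced metric. **Absolutely winning.** Let $E$ be a closed subset of a complete metric space and $S\subset E$. All balls are closed balls with a specified center and radius $R(\cdot)$. In the absolute game on $E$ with parameter $\beta\in(0,1/3)$, Bob and Alice alternately choose balls $B_1,A_1,B_2,A_2,\dots$ centered at points of $E$, with Bob choosing the $B_i$ and Alice the $A_i$, subject to $B_{i+1}\subset B_i\setminus A_i$, $R(B_{i+1})\ge\beta R(B_i)$ and $R(A_i)\le\beta R(B_i)$. $S$ is absolutely winning in $E$ if there is $\beta_0\in(0,1/3)$ such that for every $\beta\le\beta_0$ ($\beta>0$) Alice has a strategy in the game with parameter $\beta$ guaranteeing $\bigcap_i B_i\cap S\neq\emptyset$, no matter how Bob plays (the requirement being imposed on infinite plays). *)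

(* Defs.v *)
From HB Require Import structures.
From mathcomp Require Import all_boot all_order all_algebra.
From mathcomp Require Import generic_quotient.
From mathcomp Require Import all_classical all_reals all_analysis.

Set Implicit Arguments.
Unset Strict Implicit.
Unset Printing Implicit Defensive.

Import Order.TTheory GRing.Theory Num.Theory.
Import numFieldTopology.Exports.
Import numFieldNormedType.Exports.

Local Open Scope classical_set_scope.
Local Open Scope ring_scope.
Local Open Scope quotient_scope.

(* The library's [closed_ball] is the closure of the open ball, which in a
   general metric space can be smaller than the set defined here. *)
Definition cball {R : realType} {M : metricType R} (x : M) (r : R) : set M :=
  [set y | mdist x y <= r].

Definition proper_space {R : realType} (X : metricType R) :=
  forall (x : X) (r : R), compact (cball x r).

Section Geodesics.
Context {R : realType} {X : metricType R}.

Definition isometric_on (I : interval R) (c : R -> X) :=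
  {in I &, forall s t, mdist (c s) (c t) = `|s - t|}.

Definition geodesic_segment (x y : X) (S : set X) :=
  exists (a b : R) (c : R -> X),
    [/\ a <= b, isometric_on `[a, b] c, c a = x, c b = y & S = c @` `[a, b]].

Definition nbhd (delta : R) (A : set X) : set X :=
  [set x | exists2 y, A y & mdist x y <= delta].

End Geodesics.

Definition geodesic_space {R : realType} (X : metricType R) :=
  forall x y : X, exists S, geodesic_segment x y S.

Definition gromov_hyperbolic {R : realType} (X : metricType R) :=
  geodesic_space X /\
  exists2 delta : R, 0 <= delta &
    forall (a b c : X) (Sab Sac Sbc : set X),
      geodesic_segment a b Sab -> geodesic_segment a c Sac ->
      geodesic_segment b c Sbc ->
      Sbc `<=` nbhd delta Sab `|` nbhd delta Sac.

(* A ray is a function on all of [R] whose values at negative times are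
   irrelevant: they do not affect the class of the ray in the boundary. *)
Record geodesic_ray {R : realType} (X : metricType R) := GeodesicRay {
  ray_fun :> R -> X;
  ray_isometric : isometric_on `[0, +oo[ ray_fun
}.

HB.instance Definition _ (R : realType) (X : metricType R) :=
  gen_eqMixin (geodesic_ray X).
HB.instance Definition _ (R : realType) (X : metricType R) :=
  gen_choiceMixin (geodesic_ray X).

Section Boundary.
Context {R : realType} (X : metricType R).

Definition asymptotic (g h : geodesic_ray X) :=
  exists2 C : R, 0 < C & \forall t \near +oo%R, mdist (g t) (h t) < C.

Definition asymptoticb (g h : geodesic_ray X) : bool := `[< asymptotic g h >].

Let asymptoticb_refl : reflexive asymptoticb.
Proof.
move=> g; apply/asboolP; exists 1 => //.
by near=> t; rewrite mdistxx.
Unshelve. all: by end_near. Qed.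

Let asymptoticb_sym : symmetric asymptoticb.
Proof.
suff h g k : asymptotic g k -> asymptotic k g.
  by move=> g k; apply/asboolP/asboolP; exact: h.
by move=> [C C0 gk]; exists C => //; near=> t; rewrite metric_sym; near: t.
Unshelve. all: by end_near. Qed.

Let asymptoticb_trans : transitive asymptoticb.
Proof.
move=> k g h /asboolP[C C0 gk] /asboolP[D D0 kh]; apply/asboolP.
exists (C + D); first exact: addr_gt0.
near=> t; apply: (le_lt_trans (metric_triangle _ (k t) _)).
by apply: ltrD; near: t.
Unshelve. all: by end_near. Qed.

Definition asymptotic_equiv :=
  EquivRel asymptoticb asymptoticb_refl asymptoticb_sym asymptoticb_trans.

Definition boundary : Type := {eq_quot asymptotic_equiv}.
HB.instance Definition _ := Choice.on boundary.
HB.instance Definition _ := EqQuotient.on boundary.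

Definition endpoint (g : geodesic_ray X) : boundary := \pi_boundary g.

End Boundary.

Section GromovProduct.
Context {R : realType} {X : metricType R} (o : X).

Definition gromov_product (x y : X) : R :=
  (mdist x o + mdist y o - mdist x y) / 2.

(* the relation [lim_(i, j -> oo) (x_i | y_j) = oo] *)
Definition product_diverges (x y : nat -> X) :=
  (fun ij : nat * nat => gromov_product (x ij.1) (y ij.2)) @
    filter_prod \oo \oo --> +oo%R.

(* [boundary] consists of classes of rays; [x] represents the class of a ray
   [g] when [x] and [g 0, g 1, g 2, ...] are equivalent sequences. *)
Definition represents (x : nat -> X) (xi : boundary X) :=
  product_diverges x x /\
  exists2 g : geodesic_ray X,
    endpoint g = xi & product_diverges x (fun n => g n%:R).

(* Extended real valued, because [(xi | xi)] is infinite. *)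
Definition boundary_product (xi nu : boundary X) : \bar R :=
  ereal_inf [set e | exists x y : nat -> X,
    [/\ represents x xi, represents y nu &
      e = limf_einf
            (fun ij : nat * nat => (gromov_product (x ij.1) (y ij.2))%:E)
            (filter_prod \oo \oo)]].

(* For distinct boundary points [boundary_product] is finite. *)
Record visual_metric := VisualMetric {
  vdist :> boundary X -> boundary X -> R;
  vdistxx : forall x, vdist x x = 0;
  vdist_positivity : forall x y, vdist x y = 0 -> x = y;
  vdist_sym : forall x y, vdist x y = vdist y x;
  vdist_triangle : forall y x z, vdist x z <= vdist x y + vdist y z;
  vdist_visual : exists C a : R, [/\ 1 < C, 1 < a &
    forall x y, x <> y ->
      C^-1 * a `^ (- fine (boundary_product x y)) < vdist x y /\
      vdist x y < C * a `^ (- fine (boundary_product x y))]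
}.

(* The boundary as a [metricType] for the metric [rho]. *)
Definition visual_boundary (rho : visual_metric) : Type := boundary X.
HB.instance Definition _ (rho : visual_metric) :=
  Choice.copy (visual_boundary rho) (boundary X).
HB.instance Definition _ (rho : visual_metric) :=
  isMetric.Build R (visual_boundary rho) (vdistxx rho)
    (@vdist_positivity rho) (vdist_sym rho) (vdist_triangle rho).

End GromovProduct.

Section Horoballs.
Context {R : realType} {X : metricType R}.

Definition busemann (g : geodesic_ray X) (z : X) : R :=
  lim ((fun t => mdist (g t) z - t) @ +oo%R).

Definition horoball_at (xi : boundary X) (H : set X) :=
  exists (g : geodesic_ray X) (s : R),
    endpoint g = xi /\ H = [set z | busemann g z <= s].

Definition shadow (o : X) (A : set X) : set (boundary X) :=
  [set xi | exists g : geodesic_ray X,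
    [/\ g 0 = o, endpoint g = xi & exists2 t, 0 <= t & A (g t)]].

(* The infimum is over a nonempty set of reals, since the boundary is bounded
   for a visual metric. *)
Definition horoball_radius (o : X) (rho : visual_metric o)
    (xi : visual_boundary rho) (H : set X) : R :=
  inf [set r : R | shadow o H `<=` ball xi r].

Definition badly_approximable (o : X) (rho : visual_metric o) (J : Type)
    (H : J -> set X) (xi : J -> visual_boundary rho) :
    set (visual_boundary rho) :=
  [set x | exists2 s : R, 0 < s &
     forall j, s * horoball_radius (xi j) (H j) < mdist x (xi j)].

End Horoballs.

Section IsometryGroups.
Context {R : realType} {X : metricType R}.

Definition isometry (g : X -> X) :=
  bijective g /\ forall x y, mdist (g x) (g y) = mdist x y.

Definition isometry_subgroup (G : set (X -> X)) :=
  [/\ G `<=` isometry,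
      G id,
      forall g h, G g -> G h -> G (g \o h) &
      forall g, G g -> exists h, [/\ G h, cancel g h & cancel h g]].

Definition discrete_group (G : set (X -> X)) :=
  forall (x : X) (r : R), 0 < r ->
    finite_set [set g | G g /\ ball x r `&` (g @` ball x r) !=set0].

Definition limit_set (o : X) (G : set (X -> X)) : set (boundary X) :=
  [set xi | exists2 g : nat -> X -> X,
    forall i, G (g i) & represents o (fun i => g i o) xi].

Definition non_elementary (o : X) (G : set (X -> X)) :=
  infinite_set (limit_set o G).

End IsometryGroups.

Definition uniformly_perfect {R : realType} {M : metricType R} (Y : set M) :=
  exists nu : R, 0 < nu < 1 /\
    forall (x : M) (r : R), Y x -> 0 < r ->
      Y `\` ball x r !=set0 ->
      Y `&` (ball x r `\` ball x (nu * r)) !=set0.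

Section AbsoluteGame.
Context {R : realType} {M : metricType R}.

(* A move is a ball given by its center and its radius; the same set may come
   from several such pairs. *)
Definition move : Type := (M * R)%type.

Definition move_ball (b : move) : set M := cball b.1 b.2.

Definition ball_on (E : set M) (b : move) := E b.1 /\ 0 < b.2.

(* [A] and [B] list the moves of Alice and of Bob; Bob plays first. *)
Definition bob_legal (beta : R) (E : set M) (A B : nat -> move) (n : nat) :=
  ball_on E (B n) /\
  forall m, n = m.+1 ->
    move_ball (B n) `<=` move_ball (B m) `\` move_ball (A m) /\
    beta * (B m).2 <= (B n).2.

Definition alice_legal (beta : R) (E : set M) (A B : nat -> move) (n : nat) :=
  ball_on E (A n) /\ (A n).2 <= beta * (B n).2.

(* Alice's answers when she applies the strategy [sigma] to the list of the
   moves that Bob has made so far. *)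
Definition answers (sigma : seq move -> move) (B : nat -> move) : nat -> move :=
  fun n => sigma (mkseq B n.+1).

(* Alice's answers must be legal as long as Bob's moves are. *)
Definition winning_strategy (beta : R) (E S : set M)
    (sigma : seq move -> move) :=
  forall B : nat -> move,
    (forall n, (forall k, (k <= n)%N -> bob_legal beta E (answers sigma B) B k) ->
       alice_legal beta E (answers sigma B) B n) /\
    ((forall n, bob_legal beta E (answers sigma B) B n) ->
       (\bigcap_n move_ball (B n)) `&` S !=set0).

Definition absolutely_winning (E S : set M) :=
  exists beta0 : R, 0 < beta0 < 3^-1 /\
    forall beta : R, 0 < beta <= beta0 ->
      exists sigma : seq move -> move, winning_strategy beta E S sigma.

End AbsoluteGame.

(* Main.v *)
Require Import Defs.
From mathcomp Require Import all_boot all_order all_algebra.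
From mathcomp Require Import generic_quotient ring lra.
From mathcomp Require Import all_classical all_reals all_analysis.

Set Implicit Arguments.
Unset Strict Implicit.
Unset Printing Implicit Defensive.

Import Order.TTheory GRing.Theory Num.Theory.
Import numFieldNormedType.Exports.

Local Open Scope classical_set_scope.

(** Why the theorem is true.

    Measure the depth of a horoball [b <= s], where [b] is the Busemann
    function of a ray [g], by its height [h = b o - s], and its apparent size
    at infinity by [T = a^-h], where [a] is the base of the visual metric.
    Two estimates carry the geometry.

    - A ray from [o] that meets the horoball has Gromov product at least
      [h - const] with [g] ([shadow_product]), so the radius of the horoball
      is at most a constant times [T].
    - If two horoballs of heights [h], [h'] are disjoint, the Gromov product
      of their base points is at most [(h + h') / 2 + 1]
      ([disjoint_horoballs_product]), since otherwise a geodesic joining far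
      points of the two rays would be too short to leave the first horoball
      before it enters the second. Hence the distance of the base points is at
      least a constant times the geometric mean of the sizes, and in
      particular at least a constant times [r] when both sizes are at least
      [r] ([disjoint_horoballs_sizes]).

    The second estimate says that a ball of radius [r] meets, up to a constant
    factor, at most one base point whose horoball has size at least [K r]. On
    every second turn Alice removes a neighbourhood of this single base point.
    A horoball is then kept away from the outcome on the first of these turns
    whose radius is small compared with its size; by the lower bound on the
    ratio of consecutive radii, the radius on that turn is comparable to the
    size, and on the very first turn it is comparable to the largest size.
    This is bad approximability ([absolute_game_separated]).

    On the other turns Alice removes a ball around Bob's own center. Later
    centers stay away from it by a fixed multiple of the radius, so the
    compactness of the limit set forces the radii of these turns to
    be arbitrarily small, and it also produces the outcome as a cluster point
    of the centers. Compactness of the limit set ([limit_set_cluster]) is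
    proved by taking an ultrafilter limit of geodesics that join [o] to orbit
    points; properness makes the limit exist ([ray_of_long_segments]).

    All estimates on boundary points pass through Gromov products of points
    of rays. They rest on the four-point inequality for the Gromov product,
    which follows from thin triangles ([hyperbolic_four_point]). *)

(** * Two facts on real numbers *)

Section Reals.
Local Open Scope ring_scope.
Context {R : realType}.

Lemma exists_nat_ge (N : nat) (t : R) : exists2 n : nat, (N <= n)%N & t <= n%:R.
Proof.
exists (maxn N (Num.truncn t).+1); first exact: leq_maxl.
rewrite ltW// (lt_le_trans (truncnS_gt _))// ler_nat; exact: leq_maxr.
Qed.

Lemma powR_small (C a e : R) : 0 < C -> 1 < a -> 0 < e ->
  exists M, C * a `^ (- M) < e.
Proof.
move=> C0 a1 e0; exists (- (ln (e / (2 * C)) / ln a)).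
have a0 : 0 < a by lra.
rewrite opprK /powR gt_eqF// divfK; last by rewrite gt_eqF// ln_gt0.
rewrite lnK ?posrE ?divr_gt0 ?mulr_gt0//.
have -> : C * (e / (2 * C)) = e / 2 by field; rewrite gt_eqF.
lra.
Qed.

End Reals.

(** * Geodesics *)

Section Geodesics.
Local Open Scope ring_scope.
Context {R : realType} {X : metricType R}.
Implicit Types (x y p : X) (S : set X).

Lemma isometric_onP (I : interval R) (c : R -> X) :
  isometric_on I c -> forall s t, s \in I -> t \in I ->
  mdist (c s) (c t) = `|s - t|.
Proof. by move=> cI s t sI tI; exact: cI. Qed.

Lemma geodesic_segment_between x y S p : geodesic_segment x y S -> S p ->
  mdist x p + mdist p y = mdist x y.
Proof.
move=> [a [b [c [ab cI <- <- ->]]]] /= [t].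
rewrite in_itv/= => /andP[at_ tb] <-.
rewrite !(isometric_onP cI) ?in_itv/= ?lexx ?ab ?at_ ?tb//.
by rewrite !ler0_norm; lra.
Qed.

Lemma geodesic_segment_end x y S : geodesic_segment x y S -> S y.
Proof.
move=> [a [b [c [ab cI _ <- ->]]]].
by exists b => //=; rewrite in_itv/= ab lexx.
Qed.

Lemma exists_geodesic x y : geodesic_space X ->
  exists c : R -> X, [/\ c 0 = x, c (mdist x y) = y &
    isometric_on `[0, mdist x y] c].
Proof.
move=> /(_ x y)[_ [a [b [c [ab cI ca cb _]]]]].
have dxy : mdist x y = b - a.
  rewrite -ca -cb (isometric_onP cI) ?in_itv/= ?ab ?lexx//.
  by rewrite ler0_norm; lra.
exists (fun t => c (a + t)); split; first by rewrite addr0.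
  by rewrite dxy addrC subrK.
move=> s t; rewrite dxy !in_itv/= => /andP[s0 sd] /andP[t0 td].
rewrite (isometric_onP cI) ?in_itv/=; [|lra|lra].
by congr (`| _ |); lra.
Qed.

Lemma geodesic_segment_image x y (c : R -> X) :
  c 0 = x -> c (mdist x y) = y -> isometric_on `[0, mdist x y] c ->
  geodesic_segment x y (c @` `[0, mdist x y]).
Proof. by move=> *; exists 0, (mdist x y), c; split=> //; exact: mdist_ge0. Qed.

End Geodesics.

(** * The Gromov product and the four-point inequality *)

Section GromovProductBasics.
Local Open Scope ring_scope.
Context {R : realType} {X : metricType R} (o : X).
Implicit Types (x y z p : X).
Local Notation gp := (gromov_product o).

Lemma gromov_productC x y : gp x y = gp y x.
Proof. by rewrite /gromov_product (metric_sym x y); lra. Qed.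

Lemma gromov_product_ge0 x y : 0 <= gp x y.
Proof.
have := metric_triangle x o y; rewrite (metric_sym o y) /gromov_product.
lra.
Qed.

Lemma gromov_product_lipschitz x y z : gp x y - mdist y z <= gp x z.
Proof.
have := metric_triangle x y z; have := metric_triangle y z o.
rewrite /gromov_product; lra.
Qed.

Lemma gromov_product_le_dist x y p :
  mdist x p + mdist p y = mdist x y -> gp x y <= mdist o p.
Proof.
have := metric_triangle x p o; have := metric_triangle y p o.
rewrite (metric_sym p o) (metric_sym p y) /gromov_product; lra.
Qed.

Lemma gromov_product_le_dist_end x y : gp x y <= mdist x o.
Proof.
have := metric_triangle y x o; rewrite (metric_sym y x) /gromov_product; lra.
Qed.

(** Some point of the side [[x, y]] is close to both other sides: walk along it
    from [x] and stop near the last point that is close to [[o, x]]; right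
    after it the side must be close to [[o, y]]. Such a point is nearly on
    geodesics from [o] to [x] and from [o] to [y], which makes its distance
    from [o] at most the Gromov product up to an error. The supremum need not
    be attained, hence the two nearby parameters and the slack [1] in place of
    a connectedness argument. *)
Lemma thin_triangle_side (delta : R) x y (Sox Soy : set X) (c : R -> X) :
  geodesic_segment o x Sox -> geodesic_segment o y Soy ->
  c 0 = x -> c (mdist x y) = y -> isometric_on `[0, mdist x y] c ->
  0 <= delta ->
  c @` `[0, mdist x y] `<=` nbhd delta Sox `|` nbhd delta Soy ->
  exists2 t, 0 <= t <= mdist x y & mdist o (c t) <= gp x y + (2 * delta + 1).
Proof.
move=> Gx Gy c0 cd cI delta0 thin.
have d0 := mdist_ge0 x y.
pose A := [set t | 0 <= t <= mdist x y /\ nbhd delta Sox (c t)].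
have A0 : A 0.
  split; first by rewrite lexx.
  by rewrite c0; exists x; [exact: geodesic_segment_end Gx|rewrite mdistxx].
have supA : has_sup A.
  by split; [exists 0|exists (mdist x y) => t [/andP[]]].
have [t1 [t1d At1] t1s] : exists2 t, A t & sup A - 1 < t.
  exact: sup_adherent.
have t1sup : t1 <= sup A by apply: ub_le_sup => //; case: supA.
have [t2 /andP[t20 t2d] [t12 Bt2]] : exists2 t, 0 <= t <= mdist x y &
    `|t1 - t| <= 1 /\ nbhd delta Soy (c t).
  have t1nn : 0 <= t1 by case/andP: t1d.
  have t1le : t1 <= mdist x y by case/andP: t1d.
  have [dt|td] := leP (mdist x y) (t1 + 1).
    exists (mdist x y); first by rewrite lexx d0.
    split; first by rewrite ler0_norm; lra.
    by rewrite cd; exists y; [exact: geodesic_segment_end Gy|rewrite mdistxx].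
  exists (t1 + 1); first lra.
  split; first by rewrite ler0_norm; lra.
  have [|At|//] := thin (c (t1 + 1)).
    by exists (t1 + 1) => //=; rewrite in_itv/=; lra.
  suff : t1 + 1 <= sup A by lra.
  apply: ub_le_sup; first by case: supA.
  by split=> //; lra.
exists t1 => //.
case: At1 => p Sp dp; case: Bt2 => q Sq dq.
have hp := geodesic_segment_between Gx Sp.
have hq := geodesic_segment_between Gy Sq.
have t12d : mdist (c t1) (c t2) <= 1.
  by rewrite (isometric_onP cI)// in_itv/= t20.
have hx : mdist x (c t1) = t1.
  rewrite -{1}c0 (isometric_onP cI) ?in_itv/= ?lexx// ler0_norm; lra.
have hy : mdist (c t1) y = mdist x y - t1.
  rewrite -{1}cd (isometric_onP cI) ?in_itv/= ?lexx ?andbT// ler0_norm; lra.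
have := metric_triangle o p (c t1); have := metric_triangle x p (c t1).
have := metric_triangle o q (c t2); have := metric_triangle y q (c t2).
have := metric_triangle o (c t2) (c t1).
have := metric_triangle y (c t2) (c t1).
rewrite (metric_sym y (c t1)) (metric_sym (c t2) (c t1)) (metric_sym y q).
rewrite (metric_sym q (c t2)) (metric_sym p (c t1)) (metric_sym x p).
rewrite /gromov_product (metric_sym x o) (metric_sym y o); lra.
Qed.

(** Hyperbolicity in the form [(x|z) >= min ((x|y), (y|z)) - D], with the
    minimum replaced by an arbitrary common lower bound. *)
Definition four_point (D : R) := forall x y z M,
  M <= gp x y -> M <= gp y z -> M - D <= gp x z.

End GromovProductBasics.

Section FourPoint.
Local Open Scope ring_scope.
Context {R : realType} {X : metricType R} (o : X).

(** Take the point of [[x, z]] at distance about [(x|z)] from [o]. It is close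
    to [[x, y]] or to [[y, z]], and every point of these sides is at distance
    at least [(x|y)], respectively [(y|z)], from [o]. *)
Lemma hyperbolic_four_point : gromov_hyperbolic X ->
  exists2 D, 0 <= D & four_point o D.
Proof.
move=> [geo [delta delta0 thin]]; exists (3 * delta + 1); first lra.
move=> x y z M Mxy Myz.
have [Sox Gox] := geo o x; have [Soz Goz] := geo o z.
have [Sxy Gxy] := geo x y; have [Syz Gyz] := geo y z.
have [c [c0 cd cI]] := exists_geodesic x z geo.
have Gxz := geodesic_segment_image c0 cd cI.
have [t t01 ot] :=
  thin_triangle_side Gox Goz c0 cd cI delta0 (thin _ _ _ _ _ _ Gox Goz Gxz).
(* Thinness of the triangle with apex [y] asks for sides that start at [y]. *)
have Gyx : geodesic_segment y x Sxy.
  case: Gxy => a [b [e [ab eI ea eb ->]]].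
  exists (- b), (- a), (fun t => e (- t)); split; rewrite ?opprK// ?lerN2//.
    move=> s r; rewrite !in_itv/= => sI rI.
    rewrite (isometric_onP eI) ?in_itv/=; [|lra|lra].
    by rewrite -normrN; congr (`| _ |); lra.
  apply/seteqP; split=> _ [s sI <-] /=; move: sI; rewrite /= in_itv/= => sI.
    exists (- s); last by rewrite opprK.
    by rewrite in_itv/=; lra.
  by exists (- s) => //; rewrite in_itv/=; lra.
have [|[p Sp pt]|[p Sp pt]] := thin _ _ _ _ _ _ Gyx Gyz Gxz (c t).
- by exists t => //=; rewrite in_itv.
- have := gromov_product_le_dist o (geodesic_segment_between Gxy Sp).
  have := metric_triangle o (c t) p; lra.
- have := gromov_product_le_dist o (geodesic_segment_between Gyz Sp).
  have := metric_triangle o (c t) p; lra.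
Qed.

End FourPoint.

(** * Gromov products along rays and of boundary points *)

Section Rays.
Local Open Scope ring_scope.
Context {R : realType} {X : metricType R} (o : X).
Implicit Types (g h : geodesic_ray X) (x y : nat -> X) (xi eta : boundary X).
Local Notation gp := (gromov_product o).

Lemma ray_dist g s t : 0 <= s -> 0 <= t -> mdist (g s) (g t) = `|s - t|.
Proof.
move=> s0 t0.
by rewrite (isometric_onP (@ray_isometric _ _ g)) ?in_itv/= ?andbT.
Qed.

Lemma ray_gromov_product_ge g s t M : 0 <= s -> 0 <= t -> M <= s -> M <= t ->
  M - mdist (g 0) o <= gp (g s) (g t).
Proof.
move=> s0 t0 Ms Mt; rewrite /gromov_product ray_dist//.
have := metric_triangle (g s) o (g 0); have := metric_triangle (g t) o (g 0).
rewrite !ray_dist// !subr0 (ger0_norm s0) (ger0_norm t0) (metric_sym o (g 0)).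
by case: (ger0P (s - t)) => st; lra.
Qed.

Lemma endpoint_eqP g h : endpoint g = endpoint h <-> asymptotic g h.
Proof.
rewrite /endpoint; split=> [/eqmodP/asboolP//|gh].
by apply/eqmodP/asboolP.
Qed.

Lemma exists_ray xi : exists g, endpoint g = xi.
Proof. by exists (repr xi); rewrite /endpoint reprK. Qed.

(** The double-limit form of a lower bound for [(x_i|y_j)]: it is what survives
    of the filter on pairs in the definitions of divergence and of the product
    of boundary points. *)
Definition eventually_ge x y (M : R) :=
  exists N : nat, forall i j, (N <= i)%N -> (N <= j)%N -> M <= gp (x i) (y j).

Lemma product_divergesP x y :
  product_diverges o x y <-> forall M, eventually_ge x y M.
Proof.
rewrite /product_diverges; split=> [/cvgryPge xy M|xy].
  have [[P Q]/= [[n _ nP] [m _ mQ]] PQ] := xy M.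
  exists (maxn n m) => i j; rewrite !geq_max => /andP[ni mi] /andP[nj mj].
  by apply: (PQ (i, j)); split; [exact: nP|exact: mQ].
apply/cvgryPge => M; have [N NM] := xy M.
exists ([set i | (N <= i)%N], [set i | (N <= i)%N]) => /=.
  by split; exists N.
by move=> [i j] /= [Ni Nj]; exact: NM.
Qed.

Lemma eventually_geC x y M : eventually_ge x y M -> eventually_ge y x M.
Proof.
by move=> [N H]; exists N => i j Ni Nj; rewrite gromov_productC; exact: H.
Qed.

Lemma eventually_ge_trans D x y z M : four_point o D ->
  eventually_ge x y M -> eventually_ge y z M -> eventually_ge x z (M - D).
Proof.
move=> hD [N xy] [N' yz]; exists (maxn N N') => i j.
rewrite !geq_max => /andP[Ni N'i] /andP[Nj N'j].
apply: (hD _ (y (maxn N N'))); first by apply: xy => //; exact: leq_maxl.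
by apply: yz => //; exact: leq_maxr.
Qed.

Definition ray_seq g (n : nat) : X := g n%:R.

Lemma asymptotic_diverges g h M : asymptotic g h ->
  eventually_ge (ray_seq g) (ray_seq h) M.
Proof.
move=> [C C0 [T [_ gh]]].
have [n _] := exists_nat_ge 0 (Num.max (T + 1) (M + mdist (g 0) o + C)).
rewrite ge_max => /andP[Tn Mn].
exists n => i j ni nj.
have ni' : n%:R <= i%:R :> R by rewrite ler_nat.
have nj' : n%:R <= j%:R :> R by rewrite ler_nat.
have Tj : T < j%:R by lra.
have := gh j%:R Tj.
have := gromov_product_lipschitz o (g i%:R) (g j%:R) (h j%:R).
have := @ray_gromov_product_ge g i%:R j%:R (M + mdist (g 0) o + C).
rewrite /ray_seq => /(_ (ler0n _ _) (ler0n _ _)); lra.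
Qed.

(** The product of [g t] with [g u] is about [t] for [u >= t], and the same
    for [h]. Passing through a far pair [g u], [h u] of large product gives
    [(g t|h t) >= t - const], and since both points are at distance about [t]
    from [o] their mutual distance is bounded. *)
Lemma diverges_asymptotic D g h : 0 <= D -> four_point o D ->
  (forall M, eventually_ge (ray_seq g) (ray_seq h) M) -> asymptotic g h.
Proof.
move=> D0 hD gh.
have dg0 := mdist_ge0 (g 0) o; have dh0 := mdist_ge0 (h 0) o.
exists (3 * mdist (g 0) o + 3 * mdist (h 0) o + 4 * D + 1); first lra.
exists 0; split; first exact: real0.
move=> t /= t0; have [N NM] := gh t.
have [u Nu tu] := exists_nat_ge N t.
have u0 : 0 <= u%:R :> R by [].
have t0' := ltW t0.
have M1 := ray_gromov_product_ge g t0' u0 (lexx t) tu.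
have M2 := ray_gromov_product_ge h u0 t0' tu (lexx t).
have M3 := NM u u Nu Nu; rewrite /ray_seq in M3.
have M4 : t - mdist (g 0) o - mdist (h 0) o - D <= gp (g t) (h u%:R).
  by apply: (hD _ (g u%:R)); lra.
have M5 : t - mdist (g 0) o - mdist (h 0) o - D - D <= gp (g t) (h t).
  by apply: (hD _ (h u%:R)); lra.
have := metric_triangle (g t) (g 0) o; have := metric_triangle (h t) (h 0) o.
rewrite !ray_dist// !subr0 !ger0_norm//.
move: M5; rewrite /gromov_product; lra.
Qed.

Lemma represents_ray_seq g : represents o (ray_seq g) (endpoint g).
Proof.
have gg M : eventually_ge (ray_seq g) (ray_seq g) M.
  by apply: asymptotic_diverges; apply/endpoint_eqP.
split; first by apply/product_divergesP.
by exists g => //; apply/product_divergesP.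
Qed.

(** The definition of [represents] provides some ray of the class; any other
    ray of the class serves as well. *)
Lemma represents_eventually D x g M : four_point o D ->
  represents o x (endpoint g) -> eventually_ge x (ray_seq g) M.
Proof.
move=> hD [_ [h /endpoint_eqP hg /product_divergesP xh]].
rewrite -[M](addrK D); apply: eventually_ge_trans hD (xh _) _.
exact: asymptotic_diverges.
Qed.

Local Notation liminf x y := (limf_einf
  (fun ij : nat * nat => (gp (x ij.1) (y ij.2))%:E) (filter_prod \oo \oo)).

Lemma liminf_ge x y M : eventually_ge x y M -> (M%:E <= liminf x y)%E.
Proof.
move=> [N NM]; rewrite limf_einfE.
apply: (@le_trans _ _ (ereal_inf
   ((fun ij : nat * nat => (gp (x ij.1) (y ij.2))%:E) @`
     ([set i | (N <= i)%N] `*` [set i | (N <= i)%N])))).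
  apply: le_ereal_inf_tmp => _ [[i j] [/= Ni Nj] <-].
  by rewrite lee_fin; exact: NM.
apply: ereal_sup_ubound => /=.
exists ([set i | (N <= i)%N] `*` [set i | (N <= i)%N]) => //.
by exists ([set i | (N <= i)%N], [set i | (N <= i)%N]) => //; split; exists N.
Qed.

Lemma liminf_le x y M :
  (forall N : nat, exists i j,
    [/\ (N <= i)%N, (N <= j)%N & gp (x i) (y j) <= M]) ->
  (liminf x y <= M%:E)%E.
Proof.
move=> H; rewrite limf_einfE; apply: ge_ereal_sup.
move=> _ [V [[P Q]/= [[n _ nP] [m _ mQ]] PQ] <-].
have [i [j [Ni Nj ijM]]] := H (maxn n m).
apply: (@le_trans _ _ (gp (x i) (y j))%:E); last by rewrite lee_fin.
apply: ereal_inf_lbound; exists (i, j) => //; apply: PQ; split => /=.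
  by apply: nP; rewrite /= (leq_trans _ Ni)// leq_maxl.
by apply: mQ; rewrite /= (leq_trans _ Nj)// leq_maxr.
Qed.

Lemma boundary_product_ge0 xi eta : (0 <= boundary_product o xi eta)%E.
Proof.
apply: le_ereal_inf_tmp => _ [x [y [_ _ ->]]]; apply: liminf_ge.
by exists 0%N => i j _ _; exact: gromov_product_ge0.
Qed.

Lemma boundary_product_ge D g h M : four_point o D ->
  eventually_ge (ray_seq g) (ray_seq h) M ->
  ((M - D - D)%:E <= boundary_product o (endpoint g) (endpoint h))%E.
Proof.
move=> hD gh; apply: le_ereal_inf_tmp => _ [x [y [xg yh ->]]]; apply: liminf_ge.
apply: (eventually_ge_trans (y := ray_seq h)) => //; last first.
  exact/eventually_geC/(represents_eventually _ hD yh).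
apply: (eventually_ge_trans (y := ray_seq g)) => //.
exact: represents_eventually hD xg.
Qed.

Lemma boundary_product_le g h M :
  (forall N : nat, exists i j, [/\ (N <= i)%N, (N <= j)%N &
    gp (ray_seq g i) (ray_seq h j) <= M]) ->
  (boundary_product o (endpoint g) (endpoint h) <= M%:E)%E.
Proof.
move=> gh; apply: le_trans (liminf_le gh); apply: ereal_inf_lbound.
by exists (ray_seq g), (ray_seq h); split; first 1 last;
  [exact: represents_ray_seq|by []|exact: represents_ray_seq].
Qed.

(** Needed because [fine] sends infinity to [0]: an infinite product would make
    the bounds of the visual metric say nothing about small distances. *)
Lemma boundary_product_fin D xi eta : 0 <= D -> four_point o D -> xi <> eta ->
  boundary_product o xi eta \is a fin_num.
Proof.
move=> D0 hD; apply: contra_notT.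
have [g <-] := exists_ray xi; have [h <-] := exists_ray eta.
rewrite ge0_fin_numE ?boundary_product_ge0// -leNgt leye_eq => /eqP ghoo.
apply/endpoint_eqP; apply: (diverges_asymptotic D0 hD) => M.
apply: contrapT => /forallNP H.
have : (boundary_product o (endpoint g) (endpoint h) <= M%:E)%E.
  apply: boundary_product_le => N.
  have /existsNP[i /existsNP[j /not_implyP[Ni /not_implyP[Nj /negP]]]] := H N.
  by rewrite -ltNge => /ltW ?; exists i, j.
by rewrite ghoo.
Qed.

End Rays.

(** * Visual distance in terms of rays *)

Section VisualBounds.
Local Open Scope ring_scope.
Context {R : realType} {X : metricType R} {o : X}.

(** The visual metric is only used through rays: a lower bound on the Gromov
    products along two rays bounds the distance of their ends from above, and
    an upper bound, even along a subsequence, bounds it from below. The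
    constants lost in comparing the rays with arbitrary representing sequences
    are absorbed in [C]. *)
Lemma visual_bounds (D : R) (rho : visual_metric o) :
  0 <= D -> four_point o D ->
  exists C a : R, [/\ 0 < C, 1 < a,
    forall (g h : geodesic_ray X) M,
      eventually_ge o (ray_seq g) (ray_seq h) M ->
      rho (endpoint g) (endpoint h) <= C * a `^ (- M) &
    forall (g h : geodesic_ray X) M,
      (forall N : nat, exists i j, [/\ (N <= i)%N, (N <= j)%N &
        gromov_product o (ray_seq g i) (ray_seq h j) <= M]) ->
      C^-1 * a `^ (- M) <= rho (endpoint g) (endpoint h)].
Proof.
move=> D0 hD; have [C [a [C1 a1 vis]]] := vdist_visual rho.
have a0 : 0 < a by lra.
have aD : 1 <= a `^ (D + D) by rewrite -(powRr0 a) ler_powR; lra.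
exists (C * a `^ (D + D)), a; split=> //.
- by rewrite mulr_gt0//; lra.
- move=> g h M gh.
  have [->|gneh] := pselect (endpoint g = endpoint h).
    by rewrite vdistxx !mulr_ge0 ?powR_ge0//; lra.
  have [_ /ltW] := vis _ _ gneh; move=> /le_trans; apply.
  rewrite -mulrA ler_wpM2l//; first lra.
  rewrite -powRD; last by rewrite (gt_eqF a0) implybT.
  rewrite ler_powR//; first lra.
  have := boundary_product_ge hD gh.
  rewrite -(fineK (boundary_product_fin D0 hD gneh)) lee_fin; lra.
- move=> g h M gh.
  have gneh : endpoint g <> endpoint h.
    move=> /endpoint_eqP /(asymptotic_diverges o (M + 1)) [N HN].
    have [i [j [Ni Nj ijM]]] := gh N.
    have := HN i j Ni Nj; lra.
  have [/ltW + _] := vis _ _ gneh; apply: le_trans.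
  have C0 : 0 < C by lra.
  have CA0 : 0 < C * a `^ (D + D) by rewrite mulr_gt0// powR_gt0.
  rewrite ler_pM ?powR_ge0 ?invr_ge0 ?(ltW CA0)//.
  + by rewrite lef_pV2 ?posrE// ler_peMr// ltW.
  + rewrite ler_powR//; first lra.
    have := boundary_product_le gh.
    rewrite -(fineK (boundary_product_fin D0 hD gneh)) lee_fin; lra.
Qed.

End VisualBounds.

(** * Busemann functions and horoballs *)

Section Busemann.
Local Open Scope ring_scope.
Context {R : realType} {X : metricType R} (o : X).
Implicit Types (g h : geodesic_ray X) (z : X).

(** Along a ray [d(g t, z) - t] is nonincreasing and bounded below, so that the
    limit exists and is the infimum. *)
Lemma busemann_inf g z :
  let E := [set mdist (g t) z - t | t in `[0, +oo[] in
  has_inf E /\ busemann g z = inf E.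
Proof.
move=> E.
have infE : has_inf E.
  split; first by exists (mdist (g 0) z - 0), 0; rewrite //= in_itv/= lexx.
  exists (- mdist z (g 0)) => _ [t /= + <-]; rewrite in_itv/= andbT => t0.
  have := metric_triangle (g t) z (g 0).
  by rewrite ray_dist// subr0 ger0_norm//; lra.
split=> //; apply: cvg_lim => //; apply/cvgrPdist_lt => e e0.
have [_ [t /= + <-] tE] := inf_adherent e0 infE.
rewrite in_itv/= andbT => t0.
exists t; split; first exact: num_real.
move=> u tu; have u0 : 0 <= u by lra.
have : inf E <= mdist (g u) z - u.
  by apply: ge_inf; [case: infE|exists u => //=; rewrite in_itv/= u0].
have := metric_triangle (g u) (g t) z; rewrite ray_dist// ger0_norm; last lra.
by move=> *; rewrite ltr_norml; lra.
Qed.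

Lemma busemann_le g z u : 0 <= u -> busemann g z <= mdist (g u) z - u.
Proof.
move=> u0; have [[_ lbE] ->] := busemann_inf g z.
by apply: ge_inf => //; exists u => //=; rewrite in_itv/= u0.
Qed.

Lemma busemann_approx g z e : 0 < e -> exists2 t, 0 <= t &
  forall u, t <= u -> mdist (g u) z - u <= busemann g z + e.
Proof.
move=> e0; have [infE ->] := busemann_inf g z.
have [_ [t /= + <-] tE] := inf_adherent e0 infE.
rewrite in_itv/= andbT => t0; exists t => // u tu.
have := metric_triangle (g u) (g t) z; rewrite ray_dist//; last lra.
by rewrite ger0_norm; lra.
Qed.

(** Join [g i] to [h j] by a geodesic of length [d]. Its point at distance
    [tau] from [g i] has Busemann value at most [tau - i] for [g] and
    [d - tau - j] for [h]. If the Gromov product of [g i] and [h j] is large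
    then [d] is small, and [tau] can be chosen so that both values are below
    the levels [s] and [r]. *)
Lemma disjoint_horoballs_product g h s r : geodesic_space X ->
  [set z | busemann g z <= s] `&` [set z | busemann h z <= r] = set0 ->
  forall N : nat, exists i j, [/\ (N <= i)%N, (N <= j)%N &
    gromov_product o (ray_seq g i) (ray_seq h j) <=
      ((busemann g o - s) + (busemann h o - r)) / 2 + 1].
Proof.
move=> geo disj N.
have [t t0 gt] := busemann_approx g o ltr01.
have [t' t'0 ht'] := busemann_approx h o ltr01.
have [i Ni ti] := exists_nat_ge N (Num.max t (- s)).
have [j Nj tj] := exists_nat_ge N (Num.max t' (- r)).
exists i, j; split=> //; rewrite leNgt; apply/negP => big.
move: ti tj; rewrite !ge_max => /andP[ti si] /andP[tj rj].
have {}gt := gt _ ti; have {}ht' := ht' _ tj.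
rewrite /ray_seq /gromov_product in big.
have [c [c0 cd cI]] := exists_geodesic (g i%:R) (h j%:R) geo.
set d := mdist (g i%:R) (h j%:R) in cd cI big.
have d0 : 0 <= d by exact: mdist_ge0.
pose tau := Num.min d (i%:R + s).
have tau0 : 0 <= tau by rewrite le_min d0/=; lra.
have taud : tau <= d by rewrite ge_min lexx.
have taus : tau <= i%:R + s by rewrite ge_min lexx orbT.
have tauP : tau = d \/ tau = i%:R + s.
  by rewrite /tau; case: leP => _; [left|right].
suff : ([set z | busemann g z <= s] `&` [set z | busemann h z <= r]) (c tau).
  by rewrite disj.
split => /=.
  apply: (le_trans (busemann_le g _ (ler0n _ i))).
  rewrite -{1}c0 (isometric_onP cI) ?in_itv/= ?lexx ?tau0//.
  by rewrite ler0_norm; lra.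
apply: (le_trans (busemann_le h _ (ler0n _ j))).
rewrite -{1}cd (isometric_onP cI) ?in_itv/= ?lexx ?tau0 ?d0//.
rewrite ger0_norm; last lra.
by case: tauP => tauE; lra.
Qed.

(** With [u] tending to infinity, [(sg t|g u)] tends to
    [(t + b o - b (sg t)) / 2], which is at least [b o - s] because [b] is
    [1]-Lipschitz and so [t >= b o - s]. The ray [sg] itself starts at [o] and
    has product [t] with [sg t] further on. *)
Lemma shadow_product (D : R) g (sg : geodesic_ray X) (s t : R) :
  four_point o D -> sg 0 = o -> 0 <= t ->
  busemann g (sg t) <= s ->
  eventually_ge o (ray_seq sg) (ray_seq g) (busemann g o - s - 1 - D).
Proof.
move=> hD sg0 t0 bs.
have [u u0 gu] := busemann_approx g (sg t) (ltr01 : 0 < 1).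
have [n _ tun] := exists_nat_ge 0 (Num.max t u).
move: tun; rewrite ge_max => /andP[tn un].
have sgt : mdist (sg t) o = t by rewrite -sg0 ray_dist// subr0 ger0_norm.
exists n => i j ni nj.
have ni' : n%:R <= i%:R :> R by rewrite ler_nat.
have nj' : n%:R <= j%:R :> R by rewrite ler_nat.
have bo := busemann_le g o (ler0n R j).
have guj := gu j%:R (le_trans un nj').
have tri := metric_triangle (g j%:R) (sg t) o.
apply: (hD _ (sg t)); rewrite /ray_seq.
  have ti : t <= i%:R by lra.
  have := ray_gromov_product_ge o sg (ler0n R i) t0 ti (lexx t).
  by rewrite sg0 mdistxx; lra.
rewrite /gromov_product metric_sym (metric_sym (sg t) (g _)) (metric_sym o) sgt.
lra.
Qed.

End Busemann.

(** * Sizes of disjoint horoballs *)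

Section HoroballFamily.
Local Open Scope ring_scope.
Context {R : realType} {X : metricType R} (o : X).

(** If the set of admissible radii has no infimum, [inf] takes the value [0],
    which is also below [r]. *)
Lemma horoball_radius_le (rho : visual_metric o) (xi : visual_boundary rho)
    (H : set X) (r : R) : 0 <= r ->
  (forall eta, shadow o H eta -> rho xi eta < r) -> horoball_radius xi H <= r.
Proof.
move=> r0 Hr; rewrite /horoball_radius.
set E := [set _ | _].
have [infE|] := pselect (has_inf E); last by move=> /inf_out ->.
apply: ge_inf; first by case: infE.
by move=> eta /Hr; rewrite ballEmdist.
Qed.

(** All that the game needs from the horoballs: a size [T j] comparable from
    above with the radius, bounded over the family, and such that base points
    of large horoballs are far apart. The radius itself can vanish, for a
    shadow reduced to the base point, whereas [T] is positive and controls the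
    separation. *)
Lemma disjoint_horoballs_sizes (D : R) (rho : visual_metric o) (J : Type)
    (H : J -> set X) (xi : J -> visual_boundary rho) :
  geodesic_space X -> 0 <= D -> four_point o D ->
  (forall j, horoball_at (xi j) (H j)) -> trivIset setT H ->
  exists (C c Tmax : R) (T : J -> R), [/\ 0 < C, 0 < c,
    forall j, 0 < T j <= Tmax,
    forall j, horoball_radius (xi j) (H j) <= C * T j &
    forall j k r, j <> k -> 0 < r -> r <= T j -> r <= T k ->
      c * r <= mdist (xi j) (xi k)].
Proof.
move=> geo D0 hD Hhoro Hdisj.
have [C [a [C0 a1 up lo]]] := visual_bounds rho D0 hD.
have a0 : 0 < a by lra.
have /choice[gs gsP] : forall j, exists gs : geodesic_ray X * R,
    endpoint gs.1 = xi j /\ H j = [set z | busemann gs.1 z <= gs.2].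
  by move=> j; have [g [s [? ?]]] := Hhoro j; exists (g, s).
pose hgt j := busemann (gs j).1 o - (gs j).2.
have [Tmax TmaxP] : exists Tmax, forall j, a `^ (- hgt j) <= Tmax.
  (* A nonpositive height means that the horoball contains [o], which happens
     for at most one member of a disjoint family. *)
  have [[k hk]|hpos] := pselect (exists k, hgt k <= 0).
    exists (a `^ (- hgt k)) => j; have [hj|hj] := leP (hgt j) 0.
      suff -> : j = k by [].
      apply: Hdisj => //; exists o; split.
        by rewrite (gsP j).2 /=; move: hj; rewrite /hgt; lra.
      by rewrite (gsP k).2 /=; move: hk; rewrite /hgt; lra.
    by rewrite ler_powR//; lra.
  exists 1 => j; rewrite -(powRr0 a) ler_powR//; first lra.
  rewrite oppr_le0 leNgt; apply/negP => hj; apply: hpos.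
  by exists j; exact: ltW.
exists (2 * C * a `^ (1 + D)), (C^-1 * a `^ (- 1)), Tmax.
exists (fun j => a `^ (- hgt j)).
split=> //.
- by rewrite !mulr_gt0// powR_gt0.
- by rewrite !mulr_gt0 ?invr_gt0// powR_gt0.
- by move=> j; rewrite powR_gt0//=.
- move=> j; have [gxi Hj] := gsP j.
  have P : 0 < C * a `^ (1 + D) * a `^ (- hgt j) by rewrite !mulr_gt0 ?powR_gt0.
  apply: horoball_radius_le; first by move: P; rewrite -!mulrA; lra.
  move=> _ [sg [sg0 <- [t t0]]]; rewrite Hj/= => bt.
  have := up _ _ _ (shadow_product hD sg0 t0 bt).
  rewrite vdist_sym gxi => /le_lt_trans; apply.
  have -> : a `^ (- (busemann (gs j).1 o - (gs j).2 - 1 - D)) =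
            a `^ (1 + D) * a `^ (- hgt j).
    rewrite -powRD; last by rewrite (gt_eqF a0) implybT.
    by congr (_ `^ _); rewrite /hgt; lra.
  by move: P; rewrite -!mulrA; lra.
- move=> j k r jk r0 rj rk.
  have disj : [set z | busemann (gs j).1 z <= (gs j).2] `&`
              [set z | busemann (gs k).1 z <= (gs k).2] = set0.
    rewrite -(gsP j).2 -(gsP k).2 -subset0 => z Hz; apply: jk.
    by apply: Hdisj => //; exists z.
  have := lo _ _ _ (disjoint_horoballs_product o geo disj).
  rewrite (gsP j).1 (gsP k).1; apply: le_trans.
  rewrite -mulrA ler_wpM2l ?invr_ge0//; first lra.
  rewrite -/(hgt j) -/(hgt k).
  have -> : - ((hgt j + hgt k) / 2 + 1) = - 1 + - ((hgt j + hgt k) / 2) by lra.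
  rewrite powRD; last by rewrite (gt_eqF a0) implybT.
  rewrite ler_wpM2l ?powR_ge0//.
  have [hjk|hjk] := leP (hgt j) (hgt k).
    by apply: (le_trans rk); rewrite ler_powR//; lra.
  by apply: (le_trans rj); rewrite ler_powR//; lra.
Qed.

End HoroballFamily.

(** * The absolute game against a separated family of points *)

Section Game.
Local Open Scope ring_scope.
Context {R : realType} {M : metricType R}.
Implicit Types (E S : set M).

(** Sequential compactness, in a form that quantifies over indices rather than
    over subsequences. *)
Definition has_cluster_points E := forall x : nat -> M, (forall n, E (x n)) ->
  exists2 y, E y & forall (e : R) (N : nat), 0 < e ->
    exists2 n, (N <= n)%N & mdist (x n) y < e.

Lemma absolutely_winningS E S S' : S `<=` S' ->
  absolutely_winning E S -> absolutely_winning E S'.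
Proof.
move=> SS' [b0 [b0P win]]; exists b0; split=> // b bP.
have [sigma sigmaP] := win b bP; exists sigma => B.
have [legal win'] := sigmaP B; split=> // /win' [x [Bx Sx]].
by exists x; split=> //; exact: SS'.
Qed.

Context {J : Type} (xi : J -> M) (T : J -> R).
Local Notation move := (@move R M).

(** The answers with which Alice meets a large horoball based near Bob's ball:
    her center has to lie in [E], which the base point need not do. If no
    point of [E] is close to the base point there is nothing to remove. *)
Definition threat_center E (K beta : R) (b : move) : set M :=
  [set e | E e /\ exists j, [/\ K * b.2 <= T j, mdist b.1 (xi j) <= 2 * b.2 &
    mdist e (xi j) <= beta * b.2 / 2]].

(** The list of Bob's moves has odd length on turns [0, 2, 4, ...]. The other
    turns, and those without a threat, are spent on Bob's center. The point
    [x0] only serves for the empty list. *)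
Definition strategy (x0 : M) E (K beta : R) (s : seq move) : move :=
  let b := last (x0, 0) s in
  (if odd (size s) then xget b.1 (threat_center E K beta b) else b.1,
   beta * b.2).

Lemma answers_strategy x0 E K beta (B : nat -> move) n :
  answers (strategy x0 E K beta) B n =
  (if odd n then (B n).1 else xget (B n).1 (threat_center E K beta (B n)),
   beta * (B n).2).
Proof.
rewrite /answers /strategy -nth_last size_mkseq nth_mkseq//=.
by case: (odd n).
Qed.

Lemma move_ball_decreasing (beta : R) E (A B : nat -> move) :
  (forall n, bob_legal beta E A B n) ->
  forall m n, (m <= n)%N -> move_ball (B n) `<=` move_ball (B m).
Proof.
move=> legal m n /subnK <-; elim: (n - m)%N => [//|k IH].
have [_ /(_ _ erefl)[sub _]] := legal (k + m).+1.
by move=> x /sub [? _]; exact: IH.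
Qed.

(** At scale [r] at most one point of size at least [K r] is near Bob's ball,
    so that one removal per scale takes care of it, and the remaining turns
    force the scale to [0]. *)
Lemma absolute_game_separated (x0 : M) E (c Tmax : R) :
  has_cluster_points E -> 0 < c -> (forall j, 0 < T j <= Tmax) ->
  (forall j k r, j <> k -> 0 < r -> r <= T j -> r <= T k ->
    c * r <= mdist (xi j) (xi k)) ->
  absolutely_winning E (E `&` [set x | exists2 s : R, 0 < s &
    forall j, s * T j < mdist x (xi j)]).
Proof.
move=> Ecl c0 Tb sep; exists (4^-1); split; first by lra.
move=> beta /andP[b0 b4]; pose K := 5 / c.
have K0 : 0 < K by rewrite divr_gt0.
(* [c K = 5] exceeds [4]: two base points within [2 r] of the same center
   cannot both have size at least [K r]. *)
exists (strategy x0 E K beta) => B; split.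
  move=> n /(_ n (leqnn n)) [[EB r0] _].
  rewrite /alice_legal answers_strategy /= lexx; split=> //.
  split=> /=; last by rewrite mulr_gt0.
  case: (odd n) => //; case: xgetP => [e _ []//|//].
move=> legal.
have EB n : E (B n).1 by have [[]] := legal n.
have r0 n : 0 < (B n).2 by have [[]] := legal n.
have step n : beta * (B n).2 <= (B n.+1).2.
  by have [_ /(_ _ erefl)[]] := legal n.+1.
(* The outcome: a cluster point of the centers on the turns when Alice
   removes Bob's center. *)
have [y Ey ycl] := Ecl (fun k => (B k.*2.+1).1) (fun k => EB _).
have yB n : move_ball (B n) y.
  rewrite /move_ball /cball /=; apply/ler_addgt0Pr => e e0.
  have [k nk ky] := ycl e n e0.
  have nk2 : (n <= k.*2.+1)%N.
    by rewrite (leq_trans nk)// -addnn -addSn leq_addl.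
  have : move_ball (B n) (B k.*2.+1).1.
    apply: (move_ball_decreasing legal nk2).
    by rewrite /move_ball /cball /= mdistxx ltW.
  rewrite /move_ball /cball /=.
  have := metric_triangle (B n).1 (B k.*2.+1).1 y; lra.
have yA n : beta * (B n).2 < mdist (answers (strategy x0 E K beta) B n).1 y.
  have [_ /(_ _ erefl)[sub _]] := legal n.+1.
  have [_ nAy] := sub _ (yB n.+1).
  rewrite ltNge; apply/negP => Ay; apply: nAy.
  by rewrite /move_ball [X in cball _ X.2]answers_strategy.
(* The outcome avoids every ball removed around a center, but is close to some
   of these centers, so their radii are small; the turn before has a radius
   larger by a factor at most [1 / beta]. *)
have small e : 0 < e -> exists k, (B k.*2).2 < e.
  move=> e0; have be0 : 0 < beta * (beta * e) by rewrite !mulr_gt0.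
  have [k _ ky] := ycl _ 0%N be0; exists k.
  have := yA k.*2.+1; rewrite answers_strategy /= odd_double /= => yAk.
  rewrite -(ltr_pM2l b0) -(ltr_pM2l b0).
  have := step k.*2; rewrite -(ler_pM2l b0); lra.
have far k j : K * (B k.*2).2 <= T j ->
    beta * (B k.*2).2 / 2 < mdist y (xi j).
  set b := B k.*2 => Kb; have b20 : 0 < b.2 by exact: r0.
  have bb : beta * b.2 <= 4^-1 * b.2 by rewrite ler_wpM2r// ltW.
  have yb : mdist b.1 y <= b.2 := yB k.*2.
  have [near|far] := leP (mdist b.1 (xi j)) (2 * b.2); last first.
    have := metric_triangle b.1 y (xi j); lra.
  have [//|yj] := ltP (beta * b.2 / 2) (mdist y (xi j)).
  have := yA k.*2; rewrite answers_strategy odd_double /= -/b.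
  case: xgetP => [e _ [Ee [i [Ki neari ei]]]|/(_ y)[]]; last first.
    by split=> //; exists j.
  have [ij|ij] := pselect (i = j).
    rewrite ij in ei; have := metric_triangle e (xi j) y.
    rewrite (metric_sym (xi j) y); lra.
  have Kb0 : 0 < K * b.2 by rewrite mulr_gt0.
  have := sep _ _ _ ij Kb0 Ki Kb.
  rewrite mulrA /K mulrCA divff ?gt_eqF// mulr1.
  have := metric_triangle (xi i) b.1 (xi j).
  rewrite (metric_sym (xi i) b.1); lra.
exists y; split; first by move=> n _; exact: yB.
split=> //=.
have [[j0]|noj] := pselect (inhabited J); last first.
  by exists 1 => // j; exfalso; apply: noj; constructor.
have Tmax0 : 0 < Tmax by have /andP[] := Tb j0; exact: lt_le_trans.
exists (Num.min (beta * (B 0).2 / 2 / Tmax) (beta * (beta * beta) / 2 / K)).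
  by rewrite lt_min !divr_gt0// !mulr_gt0.
move=> j; have /andP[Tj0 TjM] := Tb j.
have exk : exists k, K * (B k.*2).2 <= T j.
  have [k kT] := small (T j / K) (divr_gt0 Tj0 K0).
  by exists k; rewrite ltW// mulrC -ltr_pdivlMr.
(* The first threat turn on which [xi j] counts as large. *)
have [k kT kmin] := ex_minnP exk.
apply: le_lt_trans (far _ _ kT).
case: k kT kmin => [kT _|k kT kmin].
  apply: (@le_trans _ _ (beta * (B 0).2 / 2 / Tmax * T j)).
    by rewrite ler_wpM2r ?(ltW Tj0)// ge_min lexx.
  rewrite -mulrA ger_pMr; last by rewrite !mulr_gt0.
  by rewrite mulrC ler_pdivrMr// mul1r.
have Tjk : T j < K * (B k.*2).2.
  by rewrite ltNge; apply/negP => /kmin; rewrite ltnn.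
apply: (@le_trans _ _ (beta * (beta * beta) / 2 / K * T j)).
  by rewrite ler_wpM2r ?(ltW Tj0)// ge_min lexx orbT.
apply: (@le_trans _ _ (beta * (beta * beta) / 2 / K * (K * (B k.*2).2))).
  by rewrite ler_wpM2l ?ltW// !mulr_gt0// invr_gt0.
rewrite (mulrA _ K) divfK ?gt_eqF//.
have := step k.*2; have := step k.*2.+1.
rewrite doubleS => s1 s2.
have : beta * (beta * (B k.*2).2) <= (B k.*2.+2).2.
  by apply: le_trans s1; rewrite ler_pM2l.
rewrite -(ler_pM2l b0) -(ler_pM2l (ltr0Sn _ 1)); lra.
Qed.

End Game.

(** * Compactness of the limit set *)

Section LimitSet.
Local Open Scope ring_scope.
Context {R : realType} {X : metricType R} (o : X).

(** Arzela-Ascoli for geodesics from [o] whose lengths tend to infinity: the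
    limit along an ultrafilter exists at each time by properness, for all times
    at once and without a diagonal extraction. *)
Lemma ray_of_long_segments (c : nat -> R -> X) (l : nat -> R) :
  proper_space X -> (forall n, c n 0 = o) ->
  (forall n, isometric_on `[0, l n] (c n)) -> (forall n, n%:R <= l n) ->
  exists g : geodesic_ray X, forall (t e : R) (N : nat), 0 <= t -> 0 < e ->
    exists2 n, (N <= n)%N & mdist (c n t) (g t) < e.
Proof.
move=> Xprop c0 cI ln.
have [U [UU ooU]] := ultraFilterLemma eventually_filter.
have cdist n s t : 0 <= s <= n%:R -> 0 <= t <= n%:R ->
    mdist (c n s) (c n t) = `|s - t|.
  move=> sn tn; have ? := ln n.
  by rewrite (isometric_onP (cI n))// in_itv/=; lra.
have Ularge (t : R) : U [set n | t <= n%:R].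
  apply: ooU; have [n _ tn] := exists_nat_ge 0 t.
  by exists n => // m /= nm; rewrite (le_trans tn)// ler_nat.
have /choice[g gP] : forall t : R, exists p : X, 0 <= t ->
    forall e, 0 < e -> U [set n | mdist (c n t) p < e].
  move=> t; have [t0|t0] := leP 0 t; last by exists o.
  have Ut : U [set n | cball o t (c n t)].
    apply: filterS (Ularge t) => n /= tn.
    rewrite /cball /= -{1}(c0 n) cdist ?lexx ?t0//=.
    by rewrite sub0r normrN ger0_norm.
  have [p [_ pcl]] := Xprop o t (fmap (c ^~ t) U) _ Ut.
  exists p => _ e e0.
  have [//|UC] := in_ultra_setVsetC [set n | mdist (c n t) p < e] UU.
  have [_ [[n nC <-]]] : ((c ^~ t) @` ~` [set n | mdist (c n t) p < e]) `&`
      ball p e !=set0.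
    apply: pcl; last exact: nbhsx_ballx.
    by apply: (@filterS _ U _ _ _ _ UC) => n /= ?; exists n.
  by rewrite ballEmdist /= metric_sym.
have gI : isometric_on `[0, +oo[ g.
  move=> s t; rewrite !in_itv/= !andbT => s0 t0.
  have close e : 0 < e -> `|mdist (g s) (g t) - `|s - t| | <= e.
    move=> e0; have e20 : 0 < e / 2 by lra.
    have [n [[sn tn] [cs ct]]] : [set n | (s <= n%:R) /\ (t <= n%:R)] `&`
        [set n | mdist (c n s) (g s) < e / 2 /\ mdist (c n t) (g t) < e / 2]
        !=set0.
      apply: (@filter_ex _ U); apply: filterI.
        by apply: filterI; exact: Ularge.
      by apply: filterI; exact: gP.
    have := cdist n s t; rewrite s0 t0 sn tn => /(_ isT isT) <-.
    have := metric_triangle (g s) (c n s) (g t).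
    have := metric_triangle (c n s) (c n t) (g t).
    have := metric_triangle (c n s) (g s) (c n t).
    have := metric_triangle (g s) (g t) (c n t).
    rewrite (metric_sym (g s) (c n s)) (metric_sym (g t) (c n t)).
    by rewrite ler_norml; lra.
  apply/eqP; rewrite -subr_eq0 -normr_le0; apply/ler_addgt0Pr => e e0.
  by rewrite add0r; exact: close.
exists (GeodesicRay gI) => t e N t0 e0.
have [n [Nn ce]] : [set n | (N <= n)%N] `&` [set n | mdist (c n t) (g t) < e]
    !=set0.
  apply: (@filter_ex _ U); apply: filterI; last exact: gP.
  by apply: ooU; exists N.
by exists n.
Qed.

Lemma limit_set_orbit_point (D : R) (G : set (X -> X)) xi M : four_point o D ->
  limit_set o G xi -> exists (f : X -> X) (g : geodesic_ray X) (N : nat),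
    [/\ G f, endpoint g = xi &
      forall m, (N <= m)%N -> M <= gromov_product o (f o) (ray_seq g m)].
Proof.
move=> hD [f Gf fxi]; have [g gxi] := exists_ray xi.
rewrite -gxi in fxi; have [N HN] := represents_eventually M hD fxi.
by exists (f N), g, N; split=> // m Nm; exact: HN.
Qed.

(** Replace each limit point [xi n] by an orbit point [z n] with product at
    least [n] with it, and let [g] be a limit ray of the geodesics [[o, z n]].
    If the geodesic to [z n] is close to [g] at time [T <= n], then [z n] has
    product about [T] with the end of [g]. Such [n] exist beyond any bound for
    every [T]. Hence the end of [g] is a cluster point of the [xi n], and the
    corresponding orbit points show that it is a limit point. *)
Lemma limit_set_cluster (D : R) (rho : visual_metric o) (G : set (X -> X)) :
  proper_space X -> geodesic_space X -> 0 <= D -> four_point o D ->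
  has_cluster_points (limit_set o G : set (visual_boundary rho)).
Proof.
move=> Xprop geo D0 hD xi xiG.
have [C [a [C0 a1 up _]]] := visual_bounds rho D0 hD.
have /choice[f /choice[h /choice[L fhL]]] : forall n : nat,
    exists (f : X -> X) (g : geodesic_ray X) (N : nat),
    [/\ G f, endpoint g = xi n & forall m, (N <= m)%N ->
      n%:R <= gromov_product o (f o) (ray_seq g m)].
  by move=> n; exact: (limit_set_orbit_point _ hD (xiG n)).
pose z n := f n o.
have zn n : n%:R <= mdist o (z n).
  have [_ _ /(_ _ (leqnn _)) /le_trans] := fhL n; apply.
  by rewrite metric_sym; exact: gromov_product_le_dist_end.
have /choice[c cP] : forall n, exists c : R -> X, [/\ c 0 = o,
    c (mdist o (z n)) = z n & isometric_on `[0, mdist o (z n)] c].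
  by move=> n; exact: exists_geodesic.
have [|||g gP] := @ray_of_long_segments c (fun n => mdist o (z n)) Xprop.
- by move=> n; have [] := cP n.
- by move=> n; have [] := cP n.
- exact: zn.
pose K := mdist (g 0) o + 1 + D.
have K0 : 0 <= K by have := mdist_ge0 (g 0) o; rewrite /K; lra.
have close (T : nat) n m : (T <= n)%N -> (T <= m)%N ->
    mdist (c n T%:R) (g T%:R) < 1 ->
    T%:R - K <= gromov_product o (z n) (ray_seq g m).
  move=> Tn Tm cg; have [c0 cz cI] := cP n.
  have T0 := ler0n R T.
  have Tm' : T%:R <= m%:R :> R by rewrite ler_nat.
  have Tz : T%:R <= mdist o (z n) by rewrite (le_trans _ (zn n))// ler_nat.
  have oc : mdist o (c n T%:R) = T%:R.
    rewrite -{1}c0 (isometric_onP cI) ?in_itv/= ?lexx ?mdist_ge0 ?T0//.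
    by rewrite sub0r normrN ger0_norm.
  have zc : mdist (z n) (c n T%:R) = mdist o (z n) - T%:R.
    rewrite -{1}cz (isometric_onP cI) ?in_itv/= ?lexx ?mdist_ge0 ?T0//.
    by rewrite ger0_norm// subr_ge0.
  have zg := gromov_product_lipschitz o (z n) (c n T%:R) (g T%:R).
  have gg := ray_gromov_product_ge o g T0 (ler0n R m) (lexx _) Tm'.
  have -> : T%:R - K = (T%:R - mdist (g 0) o - 1) - D by rewrite /K; lra.
  apply: (hD _ (g T%:R)); last by rewrite /ray_seq; lra.
  apply: le_trans zg; rewrite /gromov_product zc.
  rewrite (metric_sym (z n) o) (metric_sym (c n T%:R) o) oc.
  have := mdist_ge0 (g 0) o; lra.
exists (endpoint g).
  have /choice[w wP] : forall k : nat, exists n, (k <= n)%N /\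
      mdist (c n k%:R) (g k%:R) < 1.
    by move=> k; have [n kn ?] := gP k%:R 1 k (ler0n _ _) ltr01; exists n.
  exists (f \o w); first by move=> i /=; have [] := fhL (w i).
  have wg M : eventually_ge o (z \o w) (ray_seq g) M.
    have [N _ NM] := exists_nat_ge 0 (M + K + D).
    exists N => i j Ni Nj.
    have Ni' : N%:R <= i%:R :> R by rewrite ler_nat.
    have Nj' : N%:R <= j%:R :> R by rewrite ler_nat.
    have jm : j%:R <= (maxn i j)%:R :> R by rewrite ler_nat leq_maxr.
    have [iw cw] := wP i.
    have zw := close i (w i) (maxn i j) iw (leq_maxl _ _) cw.
    have gg := ray_gromov_product_ge o g (ler0n R _) (ler0n R j) jm (lexx _).
    rewrite -[M](addrK D); apply: (hD _ (ray_seq g (maxn i j))).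
      by rewrite /=; lra.
    by apply: le_trans gg; move: NM; rewrite /K; lra.
  split; last by exists g => //; apply/product_divergesP.
  apply/product_divergesP => M; rewrite -[M](addrK D).
  by apply: (eventually_ge_trans hD (wg _)); exact/eventually_geC.
move=> e N e0; have [M CM] := powR_small C0 a1 e0.
have [T NT TM] := exists_nat_ge N (M + K + D).
have [n Tn cg] := gP T%:R 1 T (ler0n _ _) ltr01.
exists n; first exact: leq_trans NT Tn.
have [_ hxi hL] := fhL n.
apply: le_lt_trans CM; rewrite -hxi; apply: up.
exists (maxn T (L n)) => i j; rewrite !geq_max => /andP[Ti Li] /andP[Tj Lj].
rewrite -[M](addrK D); apply: (hD _ (z n)).
  rewrite gromov_productC; apply: le_trans (hL i Li).
  have : T%:R <= n%:R :> R by rewrite ler_nat.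
  lra.
by apply: le_trans (close T n j Tn Tj cg); lra.
Qed.

End LimitSet.


(** * Badly approximable limit points *)

Theorem theorem1p1 (R : realType) (X : metricType R) (o : X)
    (Xproper : proper_space X) (Xgeodesic : geodesic_space X)
    (Xhyperbolic : gromov_hyperbolic X)
    (rho : visual_metric o)
    (Gamma : set (X -> X))
    (Gamma_subgroup : isometry_subgroup Gamma)
    (Gamma_discrete : discrete_group Gamma)
    (Gamma_non_elementary : non_elementary o Gamma)
    (Lambda_perfect :
       uniformly_perfect (limit_set o Gamma : set (visual_boundary rho)))
    (J : Type) (H : J -> set X) (xi : J -> visual_boundary rho)
    (H_horoball : forall j, horoball_at (xi j) (H j))
    (H_disjoint : trivIset setT H) :
  absolutely_winning (limit_set o Gamma : set (visual_boundary rho))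
    (limit_set o Gamma `&` badly_approximable H xi).
Proof.
have [D D0 hD] := hyperbolic_four_point o Xhyperbolic.
have [C [c [Tmax [T [C0 c0 Tb rad sep]]]]] :=
  disjoint_horoballs_sizes Xgeodesic D0 hD H_horoball H_disjoint.
have [x0 _] := infinite_setN0 Gamma_non_elementary.
have cluster : has_cluster_points
    (limit_set o Gamma : set (visual_boundary rho)).
  exact: limit_set_cluster Xproper Xgeodesic D0 hD.
apply: (absolutely_winningS _
  (absolute_game_separated (x0 : visual_boundary rho) cluster c0 Tb sep)).
move=> x [Gx [s s0 sx]]; split=> //; exists (s / C)%R; first exact: divr_gt0.
move=> j; apply: le_lt_trans (sx j).
rewrite -mulrA ler_pM2l// mulrC ler_pdivrMr// mulrC.
exact: rad.
Qed.
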